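(* Let $\mathfrak{A}_1,\mathfrak{A}_2$ be two $*$-algebras containing the C$^*$-algebra $\mathfrak{B}$, with positive conditional expectations $\Phi_j:\mathfrak{A}_j\to\mathfrak{B}$, $j=1,2$. Suppose that $\mathfrak{A}_1=\mathfrak{B}\oplus\mathfrak{A}_1^0$, where $\mathfrak{A}_1^0$ is a $*$-subalgebra of $\mathfrak{A}_1$ which is also a $\mathfrak{B}$-algebra, and let $\delta:\mathfrak{A}_1\to\mathfrak{B}$ be the conditional expectation $\delta(\lambda+a_0)=\lambda$ for $\lambda\in\mathfrak{B}$, $a_0\in\mathfrak{A}_1^0$. Then, on $\mathfrak{A}_1*_{\mathfrak{B}}\mathfrak{A}_2$, $$\Phi_1\rhd\Phi_2=\Phi_1*_{(\delta,\Phi_2)}\Phi_2.$$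
   Context: A conditional expectation $\Theta$ onto $\mathfrak{B}$ is a linear map with $\Theta(b_1xb_2)=b_1\Theta(x)b_2$ for $b_1,b_2\in\mathfrak{B}$ and $\Theta(b)=b$ for $b\in\mathfrak{B}$; it is positive if $\Theta(x^*x)\ge0$ for all $x$. That $\mathfrak{A}_1^0$ is a $\mathfrak{B}$-algebra means here that it is stable under left and right multiplication by $\mathfrak{B}$; the sum $\mathfrak{B}\oplus\mathfrak{A}_1^0$ is a vector space direct sum. $\mathfrak{A}=\mathfrak{A}_1*_{\mathfrak{B}}\mathfrak{A}_2$ is the algebraic free product with amalgamation over $\mathfrak{B}$. Monotonic product. $\Phi=\Phi_1\rhd\Phi_2$ is the conditional expectation $\mathfrak{A}\to\mathfrak{B}$ given by $\Phi(\alpha a_1ba_2\beta)=\Phi(\alpha a_1\Phi_2(b)a_2\beta)$, $\Phi(ba_2\beta)=\Phi_2(b)\Phi(a_2\beta)$, $\Phi(\alpha a_1b)=\Phi(\alpha a_1)\Phi_2(b)$ for all $a_1,a_2\in\mathfrak{A}_1^0$, $b\in\mathfrak{A}_2$, $\alpha,\beta\in\mathfrak{A}$ ($\alpha,\beta$ possibly absent); equivalently $\Phi(b_0a_1b_1\cdots a_nb_n)=\Phi_1(\Phi_2(b_0)a_1\Phi_2(b_1)\cdots a_n\Phi_2(b_n))$ for $b_l\in\mathfrak{A}_2$, $a_l\in\mathfrak{A}_1^0$, and analogously for words beginning and/or ending with an element of $\mathfrak{A}_1^0$, with $\Phi|_{\mathfrak{A}_j}=\Phi_j$. Conditionally free product.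 For conditional expectations $\Phi_j,\Psi_j:\mathfrak{A}_j\to\mathfrak{B}$, $j=1,2$, $\Phi_1*_{(\Psi_1,\Psi_2)}\Phi_2$ is the conditional expectation $\Phi:\mathfrak{A}\to\mathfrak{B}$ determined by $\Phi(a_1\cdots a_n)=\Phi_{\varepsilon(1)}(a_1)\cdots\Phi_{\varepsilon(n)}(a_n)$ for all $n\ge1$ and $a_i\in\mathfrak{A}_{\varepsilon(i)}$, $\varepsilon(i)\in\{1,2\}$, with $\varepsilon(1)\ne\varepsilon(2)\ne\cdots\ne\varepsilon(n)$ (consecutive indices distinct) and $\Psi_{\varepsilon(i)}(a_i)=0$ for all $i$. In the claim, $\Psi_1=\delta$ and $\Psi_2=\Phi_2$. *)

(* Defs.v *)
From HB Require Import structures.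
From mathcomp Require Import all_boot all_order all_algebra.
From mathcomp Require Import all_classical all_reals all_analysis.
From mathcomp Require Export complex.

Set Implicit Arguments.
Unset Strict Implicit.
Unset Printing Implicit Defensive.

Import Order.TTheory GRing.Theory Num.Theory.
Import numFieldNormedType.Exports.

Local Open Scope classical_set_scope.
Local Open Scope complex_scope.
Local Open Scope ring_scope.

(* Neither the C*-algebra nor the *-algebras are assumed to be unital, whereas
   every ring of MathComp has a unit: hence the following hierarchy of
   associative algebras without unit. A unital algebra is a special case, and
   if all inclusions happen to be unital, then the amalgamated free product
   defined below is the one of unital algebras (the common unit is a unit of
   any algebra generated by the factors). *)

HB.mixin Record Lmodule_isNUAlgebra (K : comNzRingType) V
    & GRing.Lmodule K V := {
  numul : V -> V -> V;
  numulA : associative numul;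
  numulDl : left_distributive numul +%R;
  numulDr : right_distributive numul +%R;
  nuscaleAl : forall (k : K) (x y : V), k *: numul x y = numul (k *: x) y;
  nuscaleAr : forall (k : K) (x y : V), k *: numul x y = numul x (k *: y)
}.

#[short(type="nuAlgType")]
HB.structure Definition NUAlgebra (K : comNzRingType) :=
  {V of GRing.Lmodule K V & Lmodule_isNUAlgebra K V}.

Notation "x ** y" := (numul x y) (at level 40, left associativity) : ring_scope.

HB.mixin Record NUAlgebra_isStar (R : realType) V & NUAlgebra R[i] V := {
  star : V -> V;
  starK : involutive star;
  starD : {morph star : x y / x + y};
  starZ : forall (k : R[i]) (x : V), star (k *: x) = k^* *: star x;
  starM : forall x y : V, star (x ** y) = star y ** star x
}.

#[short(type="starAlgType")]
HB.structure Definition StarAlgebra (R : realType) :=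
  {V of NUAlgebra R[i] V & NUAlgebra_isStar R V}.

HB.mixin Record StarAlgebra_isCStar (R : realType) V
    & StarAlgebra R V & CompleteNormedModule R[i] V := {
  cstar_normM : forall x y : V, `|x ** y| <= `|x| * `|y|;
  cstar_norm : forall x : V, `|star x ** x| = `|x| ^+ 2
}.

#[short(type="cstarAlgType")]
HB.structure Definition CStarAlgebra (R : realType) :=
  {V of StarAlgebra R V & CompleteNormedModule R[i] V
      & StarAlgebra_isCStar R V}.

Definition nualg_hom (K : comNzRingType) (U V : nuAlgType K) (f : U -> V) :=
  linear f /\ {morph f : x y / x ** y}.

Definition star_hom (R : realType) (U V : starAlgType R) (f : U -> V) :=
  nualg_hom f /\ {morph f : x / star x}.

Definition star_subalgebra (R : realType) (V : starAlgType R) (S : set V) :=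
  [/\ S 0,
      forall (k : R[i]) x y, S x -> S y -> S (k *: x + y),
      forall x y, S x -> S y -> S (x ** y) &
      forall x, S x -> S (star x)].

(* An inclusion "B contained in A" is an injective *-homomorphism [e : B -> A]. *)
Definition star_inclusion (R : realType) (B A : starAlgType R) (e : B -> A) :=
  star_hom e /\ injective e.

Section ConditionalExpectations.
Context (R : realType) (B : cstarAlgType R) (A : starAlgType R) (e : B -> A).

Definition bimodule_stable (S : set A) :=
  forall b x, S x -> S (e b ** x) /\ S (x ** e b).

Definition direct_sum_with (S : set A) :=
  (forall a, exists b x, S x /\ a = e b + x) /\ (forall b, S (e b) -> b = 0).

Definition cond_exp (T : A -> B) :=
  [/\ linear T,
      forall b1 b2 x, T (e b1 ** x ** e b2) = b1 ** T x ** b2 &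
      forall b, T (e b) = b].

Definition cstar_nonneg (b : B) := exists c : B, b = star c ** c.

Definition positive_map (T : A -> B) :=
  forall x, cstar_nonneg (T (star x ** x)).

End ConditionalExpectations.

(* The algebraic amalgamated free product, as the pushout of [e1] and [e2] in
   complex algebras; its involution is the one extending those of A1, A2. *)
Definition amalgamated_free_product (R : realType) (B : cstarAlgType R)
    (A1 A2 A : starAlgType R) (e1 : B -> A1) (e2 : B -> A2)
    (i1 : A1 -> A) (i2 : A2 -> A) :=
  [/\ star_hom i1, star_hom i2, i1 \o e1 =1 i2 \o e2 &
      forall (D : nuAlgType R[i]) (f1 : A1 -> D) (f2 : A2 -> D),
        nualg_hom f1 -> nualg_hom f2 -> f1 \o e1 =1 f2 \o e2 ->
        exists! h : A -> D,
          [/\ nualg_hom h, h \o i1 =1 f1 & h \o i2 =1 f2]].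

(* [sandwich u v x] is u x v, where each of u and v may be absent. *)
Definition sandwich (K : comNzRingType) (V : nuAlgType K)
    (u v : option V) (x : V) : V :=
  let ux := if u is Some u' then u' ** x else x in
  if v is Some v' then ux ** v' else ux.

Definition monotonic_product (R : realType) (B : cstarAlgType R)
    (A1 A2 A : starAlgType R) (e1 : B -> A1) (e2 : B -> A2)
    (i1 : A1 -> A) (i2 : A2 -> A) (A10 : set A1)
    (Phi1 : A1 -> B) (Phi2 : A2 -> B) (Phi : A -> B) :=
  [/\ cond_exp (i1 \o e1) Phi,
      (Phi \o i1 =1 Phi1) /\ (Phi \o i2 =1 Phi2),
      forall (alpha beta : option A) (a1 a2 : A1) (b : A2), A10 a1 -> A10 a2 ->
        Phi (sandwich alpha beta (i1 a1 ** i2 b ** i1 a2))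
        = Phi (sandwich alpha beta (i1 a1 ** i2 (e2 (Phi2 b)) ** i1 a2)),
      forall (beta : option A) (a2 : A1) (b : A2), A10 a2 ->
        Phi (sandwich None beta (i2 b ** i1 a2))
        = Phi2 b ** Phi (sandwich None beta (i1 a2)) &
      forall (alpha : option A) (a1 : A1) (b : A2), A10 a1 ->
        Phi (sandwich alpha None (i1 a1 ** i2 b))
        = Phi (sandwich alpha None (i1 a1)) ** Phi2 b].

(* The product of the nonempty word [x :: s]. *)
Definition word_prod (K : comNzRingType) (V : nuAlgType K) (x : V) (s : seq V) :=
  foldl numul x s.

(* A letter of A1 + A2 carries its index: [inl] for 1 and [inr] for 2. *)
Definition sum_case (T1 T2 T : Type) (f1 : T1 -> T) (f2 : T2 -> T)
    (z : T1 + T2) : T :=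
  match z with inl a => f1 a | inr a => f2 a end.

Definition letter_alternates (T1 T2 : Type) : rel (T1 + T2) :=
  fun z z' => (if z is inl _ then true else false)
              != (if z' is inl _ then true else false).

Definition cfree_product (R : realType) (B : cstarAlgType R)
    (A1 A2 A : starAlgType R) (e1 : B -> A1)
    (i1 : A1 -> A) (i2 : A2 -> A)
    (Psi1 : A1 -> B) (Psi2 : A2 -> B)
    (Phi1 : A1 -> B) (Phi2 : A2 -> B) (Phi : A -> B) :=
  cond_exp (i1 \o e1) Phi /\
  forall (z : A1 + A2) (w : seq (A1 + A2)),
    path (@letter_alternates A1 A2) z w ->
    (forall y, y \in z :: w -> sum_case Psi1 Psi2 y = 0) ->
    Phi (word_prod (sum_case i1 i2 z) [seq sum_case i1 i2 y | y <- w])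
    = word_prod (sum_case Phi1 Phi2 z) [seq sum_case Phi1 Phi2 y | y <- w].

(* Main.v *)
From HB Require Import structures.
Require Import Defs.
From mathcomp Require Import all_boot all_order all_algebra.
From mathcomp Require Import all_classical all_reals all_analysis.

(** Write A1 as the direct sum of B and the ideal A10, so that [delta] is the
    projection onto B, and call a letter centered if it lies in A10 = ker delta
    or in ker Phi2.

    A monotonic product is conditionally free. Let an alternating word of
    centered letters contain a letter b of A2. The defining rules of the
    monotonic product replace b by [Phi2 b], which is 0, whether b begins the
    word, ends it or stands between two letters of A10; as letters alternate
    there is no other case, and looking at the first three letters suffices. The
    prescribed value also has the factor [Phi2 b], so both are 0. A word without
    a letter of A2 is a single letter of A10, where both sides are its image
    under Phi1 ([monotonic_cfree]).

    A conditionally free product is unique. B and the alternating centered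
    words span A, because their span contains the generators and is stable
    under left multiplication by the letters: the product of two letters of A10
    is in A10, and a letter c of A2 is [Phi2 c] plus an element of ker Phi2
    ([centered_words_span]). The values of a conditionally free product are
    prescribed on this spanning set ([cfree_unique]). By the first part,
    monotonic products are then unique as well.

    It remains to construct one monotonic product. The free product is only
    known through its universal property, so A is made to act on a vector
    space W and Phi is read off from the image of one vector. Let M be A1
    with an adjoined unit. Then W is the space of left B-linear maps from A2
    with an adjoined unit to M, the module coinduced from B. The algebra A2
    acts by right translation of the argument, (b p)(x) = p(x b), and A10 by
    (a p)(x) = Phi2(x) a p(1); the action of B by translation completes the
    latter to an action of A1. From the vacuum vector x |-> Phi2(x), 1 |->
    1, a word b0 a1 b1 ... an bn with a_i in A10 produces a vector whose
    value at 1 is Phi2(b0) a1 Phi2(b1) ... an Phi2(bn), and Phi is the image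
    of this value under Phi1. The two occurrences of an adjoined unit
    account for the algebras not being unital. *)

Set Implicit Arguments.
Unset Strict Implicit.
Unset Printing Implicit Defensive.

Import Order.TTheory GRing.Theory Num.Theory.
Local Open Scope classical_set_scope.
Local Open Scope complex_scope.
Local Open Scope ring_scope.

(** * Linear maps, subspaces and spans *)

Section LinearMaps.
Context (K : comNzRingType) (U V : lmodType K) (f : U -> V) (lf : linear f).

Lemma lin0 : f 0 = 0.
Proof. by have := lf (-1) 0 0; rewrite scaler0 addr0 scaleN1r addNr. Qed.
Lemma linD x y : f (x + y) = f x + f y.
Proof. by have := lf 1 x y; rewrite !scale1r. Qed.
Lemma linB x y : f (x - y) = f x - f y.
Proof. exact: zmod_morphism_linear. Qed.

End LinearMaps.

Section LinearMapsSpace.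
Context (K : comNzRingType) (U V : lmodType K).

Lemma linear_map0 : linear (0 : U -> V).
Proof. by move=> k x y; apply/esym; exact: etrans (addr0 _) (scaler0 _ _). Qed.

Lemma linear_mapZD (k : K) (f g : U -> V) :
  linear f -> linear g -> linear (k *: f + g).
Proof.
move=> lf lg l x y; rewrite -![(k *: f + g) _]/(k *: f _ + g _) lf lg.
by rewrite !scalerDr !scalerA mulrC addrACA.
Qed.

End LinearMapsSpace.

Record lin_subspace (K : comNzRingType) (V : lmodType K) := LinSubspace {
  subspace_set :> V -> Prop;
  subspace0 : subspace_set 0;
  subspaceZD : forall (k : K) x y,
    subspace_set x -> subspace_set y -> subspace_set (k *: x + y) }.

Section SubspaceType.
Context (K : comNzRingType) (V : lmodType K) (S : lin_subspace V).

Lemma subspaceD x y : S x -> S y -> S (x + y).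
Proof. by move=> Sx Sy; rewrite -[x]scale1r; exact: subspaceZD. Qed.

Lemma subspaceZ k x : S x -> S (k *: x).
Proof.
move=> Sx; rewrite -[_ *: _]addr0.
by apply: subspaceZD => //; exact: subspace0.
Qed.

Definition subspace_type := {x : V | `[< S x >]}.

HB.instance Definition _ := [isSub for (fun x : subspace_type => sval x)].
HB.instance Definition _ := [Choice of subspace_type by <:].

Lemma subspace_closed : GRing.subsemimod_closed (fun x : V => `[< S x >]).
Proof.
split; first split.
- by apply/asboolP; exact: subspace0.
- by move=> x y /asboolP Sx /asboolP Sy; apply/asboolP; exact: subspaceD.
- by move=> k x /asboolP Sx; apply/asboolP; exact: subspaceZ.
Qed.

HB.instance Definition _ :=
  GRing.SubChoice_isSubLmodule.Build K V _ subspace_type subspace_closed.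

Lemma subspace_typeP (x : subspace_type) : S (\val x).
Proof. by apply/asboolP; exact: (valP x). Qed.

Definition in_subspace x (Sx : S x) : subspace_type :=
  exist _ x (asboolT Sx).

End SubspaceType.

Section Span.
Context (K : comNzRingType) (V : lmodType K) (G : V -> Prop).

(** The span is taken as the intersection of all subspaces containing [G]:
    linear maps are then compared on it without writing down combinations. *)
Definition in_span (x : V) :=
  forall S : lin_subspace V, (forall g, G g -> S g) -> S x.

Lemma in_span0 : in_span 0.
Proof. by move=> S _; exact: subspace0. Qed.

Lemma in_spanZD (k : K) x y : in_span x -> in_span y -> in_span (k *: x + y).
Proof. by move=> Gx Gy S GS; apply: subspaceZD; [exact: Gx | exact: Gy]. Qed.

Definition linear_span : lin_subspace V := LinSubspace in_span0 in_spanZD.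

Lemma span_incl x : G x -> linear_span x.
Proof. by move=> Gx S; exact. Qed.

Lemma span_linear (f : V -> V) : linear f ->
  (forall g, G g -> linear_span (f g)) ->
  forall x, linear_span x -> linear_span (f x).
Proof.
move=> lf Gf x Gx.
have f0 : linear_span (f 0).
  by rewrite (lin0 lf); exact: subspace0.
have fZD (k : K) y z : linear_span (f y) -> linear_span (f z) ->
    linear_span (f (k *: y + z)).
  by rewrite lf; exact: subspaceZD.
exact: (Gx (LinSubspace f0 fZD)).
Qed.

End Span.

(** * Algebras of endomorphisms and subalgebras *)

Section EndomorphismAlgebra.
Context (K : comNzRingType) (V : lmodType K).

Definition linear_maps : lin_subspace (V -> V) :=
  @LinSubspace _ _ (fun f : V -> V => linear f)
    (@linear_map0 _ V V) (@linear_mapZD _ V V).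

Definition lin_end := subspace_type linear_maps.
HB.instance Definition _ := GRing.Lmodule.on lin_end.

Lemma linear_comp (f g : V -> V) : linear f -> linear g -> linear (f \o g).
Proof. by move=> lf lg k x y; rewrite /= lg lf. Qed.

Definition lin_end_mul (f g : lin_end) : lin_end :=
  @in_subspace _ _ linear_maps _
    (linear_comp (subspace_typeP f) (subspace_typeP g)).

Let mulA : associative lin_end_mul.
Proof. by move=> f g h; apply: val_inj. Qed.
Let mulDl : left_distributive lin_end_mul +%R.
Proof. by move=> f g h; apply: val_inj. Qed.
Let mulDr : right_distributive lin_end_mul +%R.
Proof.
move=> f g h; apply: val_inj; apply/funext => x /=.
by have := subspace_typeP f 1 (\val g x) (\val h x); rewrite !scale1r.
Qed.
Let scaleAl (k : K) (f g : lin_end) :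
  k *: lin_end_mul f g = lin_end_mul (k *: f) g.
Proof. exact: val_inj. Qed.
Let scaleAr (k : K) (f g : lin_end) :
  k *: lin_end_mul f g = lin_end_mul f (k *: g).
Proof.
apply: val_inj; apply/funext => x.
exact/esym/(scalable_linear (subspace_typeP f)).
Qed.

HB.instance Definition _ := Lmodule_isNUAlgebra.Build K lin_end
  mulA mulDl mulDr scaleAl scaleAr.

Lemma lin_endZD (k : K) (f g : lin_end) x :
  \val (k *: f + g) x = k *: \val f x + \val g x.
Proof.
by have -> : \val (k *: f + g) = k *: \val f + \val g by exact: linearP.
Qed.

Lemma lin_endM (f g : lin_end) x : \val (f ** g) x = \val f (\val g x).
Proof. by []. Qed.

End EndomorphismAlgebra.

Section SubalgebraType.
Context (K : comNzRingType) (V : nuAlgType K) (S : lin_subspace V).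
Context (SM : forall x y, S x -> S y -> S (x ** y)).

(** The phantom argument records the closure under products, on which the
    algebra structure of this type depends. *)
Definition subalgebra_type & (forall x y, S x -> S y -> S (x ** y)) :=
  subspace_type S.
Local Notation T := (subalgebra_type SM).
HB.instance Definition _ := GRing.SubLmodule.on T.

Definition subalgebra_mul (x y : T) : T :=
  in_subspace (SM (subspace_typeP x) (subspace_typeP y)).

Let mulA : associative subalgebra_mul.
Proof. by move=> f g h; apply: val_inj; rewrite /= numulA. Qed.
Let mulDl : left_distributive subalgebra_mul +%R.
Proof. by move=> f g h; apply: val_inj; rewrite /= numulDl. Qed.
Let mulDr : right_distributive subalgebra_mul +%R.
Proof. by move=> f g h; apply: val_inj; rewrite /= numulDr. Qed.
Let scaleAl (k : K) (f g : T) :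
  k *: subalgebra_mul f g = subalgebra_mul (k *: f) g.
Proof. by apply: val_inj; rewrite /= nuscaleAl. Qed.
Let scaleAr (k : K) (f g : T) :
  k *: subalgebra_mul f g = subalgebra_mul f (k *: g).
Proof. by apply: val_inj; rewrite /= nuscaleAr. Qed.

HB.instance Definition _ := Lmodule_isNUAlgebra.Build K T
  mulA mulDl mulDr scaleAl scaleAr.

End SubalgebraType.

(** * Words in algebras without unit *)

Section NonUnitalAlgebra.
Context (K : comNzRingType) (V : nuAlgType K).
Implicit Types x y : V.

Lemma numul0l x : 0 ** x = 0.
Proof. by apply: (addIr (0 ** x)); rewrite -numulDl !add0r. Qed.

Lemma numul0r x : x ** 0 = 0.
Proof. by apply: (addIr (x ** 0)); rewrite -numulDr !add0r. Qed.

Lemma numulNl x y : (- x) ** y = - (x ** y).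
Proof. by apply/eqP; rewrite -addr_eq0 -numulDl addNr numul0l. Qed.

Lemma numulNr x y : x ** (- y) = - (x ** y).
Proof. by apply/eqP; rewrite -addr_eq0 -numulDr addNr numul0r. Qed.

Lemma word_prod_mull x y s : word_prod (x ** y) s = x ** word_prod y s.
Proof. by elim: s y => //= z s IHs y; rewrite -numulA IHs. Qed.

Lemma word_prod0 s : word_prod (0 : V) s = 0.
Proof. by elim: s => //= z s; rewrite numul0l. Qed.

End NonUnitalAlgebra.

(** * Conditional expectations onto a C*-algebra *)

Section CStar.
Context (R : realType) (B : cstarAlgType R).

Lemma cstar_faithful (d : B) : star d ** d = 0 -> d = 0.
Proof.
move=> d0; have := cstar_norm d; rewrite d0 normr0 => /esym/eqP.
by rewrite expf_eq0 normr_eq0 => /eqP.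
Qed.

(** For c = d^* and c' = d^* d the hypothesis reads y^* y = 0 with y = d^* d,
    and the C*-identity applies twice. This replaces an approximate unit of B.
*)
Lemma cstar_sandwich_faithful (d : B) :
  (forall c c', c ** d ** c' = 0) -> d = 0.
Proof.
move=> d0; apply/cstar_faithful/cstar_faithful.
by rewrite starM starK d0.
Qed.

Context (A : starAlgType R) (e : B -> A) (he : star_hom e).
Context (T : A -> B) (hT : cond_exp e T).

(** The bimodule property is given for two-sided products only, and B may lack a
    unit; but both sides agree after multiplication by any c on the left and c'
    on the right, which separates the elements of B. *)
Lemma cond_exp_mull b x : T (e b ** x) = b ** T x.
Proof.
case: hT he => _ Tmod _ [[_ eM] _].
apply/eqP; rewrite -subr_eq0; apply/eqP/cstar_sandwich_faithful => c c'.
rewrite numulDr numulDl numulNr numulNl -Tmod !numulA -eM Tmod.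
by rewrite subrr.
Qed.

Lemma cond_exp_mulr b x : T (x ** e b) = T x ** b.
Proof.
case: hT he => _ Tmod _ [[_ eM] _].
apply/eqP; rewrite -subr_eq0; apply/eqP/cstar_sandwich_faithful => c c'.
rewrite numulDr numulDl numulNr numulNl -Tmod !numulA.
by rewrite -![_ ** e b ** e c']numulA -eM Tmod numulA subrr.
Qed.

End CStar.

(** * Generation of the amalgamated free product *)

Section Pushout.
Context (R : realType) (B : cstarAlgType R).
Context (A1 A2 A : starAlgType R) (e1 : B -> A1) (e2 : B -> A2).
Context (i1 : A1 -> A) (i2 : A2 -> A).
Context (hA : amalgamated_free_product e1 e2 i1 i2).

(** The canonical maps corestrict to S, so the universal property yields a map
    from A to S; composed with the inclusion it is the identity, by the
    uniqueness part of the universal property for A itself. *)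
Lemma free_product_generated (S : lin_subspace A) :
  (forall x y, S x -> S y -> S (x ** y)) ->
  (forall a, S (i1 a)) -> (forall b, S (i2 b)) -> forall x, S x.
Proof.
move=> SM S1 S2 x; case: hA => -[[l1 M1] _] [[l2 M2] _] i12 univ.
pose D : nuAlgType R[i] := subalgebra_type SM.
pose g1 a : D := in_subspace (S1 a); pose g2 b : D := in_subspace (S2 b).
have [||?|h [[[lh Mh] h1 h2] _]] := univ D g1 g2.
- by split=> [k a a'|a a']; apply: val_inj; rewrite /= ?l1 ?M1.
- by split=> [k a a'|a a']; apply: val_inj; rewrite /= ?l2 ?M2.
- by apply: val_inj; exact: i12.
have [|||id' [_ id'_uniq]] := univ A i1 i2 => //.
have hid : id' = idfun by apply: id'_uniq; split.
have hh : id' = \val \o h.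
  apply: id'_uniq; split.
  - by split=> [k a a'|a a'] /=; rewrite ?lh ?Mh.
  - by move=> a /=; have /= -> := h1 a.
  - by move=> a /=; have /= -> := h2 a.
have -> : x = \val (h x) by rewrite -[LHS]/(idfun x) -hid hh.
exact: subspace_typeP.
Qed.

(** It suffices to multiply by letters on the left: the x in S such that
    x S is contained in S form a subalgebra containing the letters. *)
Lemma free_product_left_ind (A10 : set A1) (S : lin_subspace A) :
  direct_sum_with e1 A10 ->
  (forall a, A10 a -> S (i1 a)) -> (forall b, S (i2 b)) ->
  (forall a x, A10 a -> S x -> S (i1 a ** x)) ->
  (forall b x, S x -> S (i2 b ** x)) -> forall x, S x.
Proof.
move=> [dec _] S1 S2 L1 L2; case: (hA) => -[[l1 M1] _] _ i12 _.
have S1' a : S (i1 a).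
  have [b [a0 [Aa0 ->]]] := dec a; rewrite (linD l1); apply: subspaceD.
    by have /= -> := i12 b.
  exact: S1.
have L1' a x : S x -> S (i1 a ** x).
  move=> Sx; have [b [a0 [Aa0 ->]]] := dec a.
  rewrite (linD l1) numulDl; apply: subspaceD; last exact: L1.
  by have /= -> := i12 b; exact: L2.
pose P x := S x /\ forall y, S y -> S (x ** y).
have P0 : P 0 by split=> [|y _]; rewrite ?numul0l; exact: subspace0.
have PZD k x y : P x -> P y -> P (k *: x + y).
  move=> [Sx Px] [Sy Py]; split=> [|z Sz]; first exact: subspaceZD.
  by rewrite numulDl -nuscaleAl; apply: subspaceZD; auto.
move=> x; suff: P x by case.
apply: (free_product_generated (S := LinSubspace P0 PZD)) =>
  [u v [Su Pu] [Sv Pv]|a|b].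
- by split=> [|y Sy]; rewrite -?numulA; auto.
- by split; auto.
- by split; auto.
Qed.

End Pushout.

(** * The splitting of the first factor *)

Section Delta.
Context (R : realType) (B : cstarAlgType R) (A1 : starAlgType R) (e1 : B -> A1).
Context (he1 : star_inclusion e1).
Context (A10 : set A1) (subA10 : star_subalgebra A10).
Context (bimA10 : bimodule_stable e1 A10) (dirA10 : direct_sum_with e1 A10).
Context (delta : A1 -> B).
Context (hdelta : forall (l : B) (a0 : A1), A10 a0 -> delta (e1 l + a0) = l).

Definition ideal_part a := a - e1 (delta a).

Lemma delta_split a : a = e1 (delta a) + ideal_part a.
Proof. by rewrite /ideal_part addrC subrK. Qed.

Lemma ideal_partP a : A10 (ideal_part a).
Proof.
have [b [x [Ax aE]]] := dirA10.1 a.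
by rewrite /ideal_part {2}aE hdelta // aE addrC addrA addNr add0r.
Qed.

Lemma delta_ideal a : A10 a -> delta a = 0.
Proof.
case: he1 => -[[l1 _] _] _ Aa; have := hdelta 0 Aa.
by rewrite (lin0 l1) add0r.
Qed.

Lemma delta_eq0 a : delta a = 0 -> A10 a.
Proof.
case: he1 => -[[l1 _] _] _ a0; have := ideal_partP a.
by rewrite /ideal_part a0 (lin0 l1) subr0.
Qed.

Lemma delta_incl b : delta (e1 b) = b.
Proof.
by have [A0 _ _ _] := subA10; have := hdelta b A0; rewrite addr0.
Qed.

Lemma delta_linear : linear delta.
Proof.
case: he1 => -[[l1 _] _] _; have [_ AZD _ _] := subA10 => k x y.
rewrite {1}(delta_split x) {1}(delta_split y) scalerDr addrACA -l1 hdelta //.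
by apply: AZD; exact: ideal_partP.
Qed.

Lemma ideal_part_mul x y :
  ideal_part (x ** y) = e1 (delta x) ** ideal_part y + ideal_part x ** y /\
  delta (x ** y) = delta x ** delta y.
Proof.
case: he1 => -[[l1 M1] _] _; have [A0 AZD AM _] := subA10.
have xyE : x ** y = e1 (delta x ** delta y) +
    (e1 (delta x) ** ideal_part y + ideal_part x ** y).
  by rewrite M1 addrA -numulDr -delta_split -numulDl -delta_split.
have Axy : A10 (e1 (delta x) ** ideal_part y + ideal_part x ** y).
  rewrite -[X in X + _]scale1r; apply: (AZD 1).
    by have [] := bimA10 (delta x) (ideal_partP y).
  rewrite {1}(delta_split y) numulDr -[X in X + _]scale1r; apply: (AZD 1).
    by have [] := bimA10 (delta y) (ideal_partP x).
  by apply: AM; exact: ideal_partP.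
have dxy : delta (x ** y) = delta x ** delta y by rewrite xyE hdelta.
by split=> //; rewrite {1}/ideal_part dxy xyE addrC addrA addNr add0r.
Qed.

Lemma ideal_part_linear : linear ideal_part.
Proof.
case: he1 => -[[l1 _] _] _ k x y.
by rewrite /ideal_part delta_linear l1 scalerBr opprD addrACA.
Qed.

End Delta.

(** * Monotonic products, conditionally free products and centered words *)

Section FreeProductFunctionals.
Context (R : realType) (B : cstarAlgType R).
Context (A1 A2 A : starAlgType R) (e1 : B -> A1) (e2 : B -> A2).
Context (he1 : star_inclusion e1) (he2 : star_inclusion e2).
Context (Phi1 : A1 -> B) (Phi2 : A2 -> B).
Context (hPhi1 : cond_exp e1 Phi1) (hPhi2 : cond_exp e2 Phi2).
Context (A10 : set A1) (subA10 : star_subalgebra A10).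
Context (bimA10 : bimodule_stable e1 A10) (dirA10 : direct_sum_with e1 A10).
Context (delta : A1 -> B).
Context (hdelta : forall (l : B) (a0 : A1), A10 a0 -> delta (e1 l + a0) = l).
Context (i1 : A1 -> A) (i2 : A2 -> A).
Context (hA : amalgamated_free_product e1 e2 i1 i2).

Local Notation img := (sum_case i1 i2).
Local Notation val := (sum_case Phi1 Phi2).
Local Notation alt := (@letter_alternates A1 A2).

(** The first three letters of a centered word show that both sides vanish,
    unless the word is a single letter of A10. *)
Lemma monotonic_cfree (Phi : A -> B) :
  monotonic_product e1 e2 i1 i2 A10 Phi1 Phi2 Phi ->
  cfree_product e1 i1 i2 delta Phi2 Phi1 Phi2 Phi.
Proof.
move=> [ce [P1 P2] mid left right]; split=> // z w; case: (ce) => lPhi _ _.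
have l2 : linear i2 by case: hA => _ [[]].
have le2 : linear e2 by case: he2 => -[[]].
have opt (x : A) s : exists beta, word_prod x s = sandwich None beta x.
  case: s => [|t s]; first by exists None.
  by exists (Some (word_prod t s)); rewrite /= -word_prod_mull.
have zeroA a : delta a = 0 -> A10 a by apply: delta_eq0; eassumption.
case: z => [a|b].
- case: w => [_ _|[a'|b] w] //=; first exact: P1.
  move=> w_alt zero.
  have Aa : A10 a by apply: zeroA; apply: (zero (inl a)); rewrite mem_head.
  have b0 : Phi2 b = 0 by apply: (zero (inr b)); rewrite !inE eqxx orbT.
  rewrite b0 numul0r word_prod0.
  case: w w_alt zero => [_ _|[a'|b'] w] //=.
    by rewrite [LHS](right None) // b0 numul0r.
  move=> _ zero.
  have Aa' : A10 a'.
    by apply: zeroA; apply: (zero (inl a')); rewrite !inE eqxx !orbT.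
  have [beta ->] := opt (i1 a ** i2 b ** i1 a') [seq img y | y <- w].
  rewrite mid // b0 (lin0 le2) (lin0 l2) numul0r numul0l.
  by case: beta => [y|] /=; rewrite ?numul0l (lin0 lPhi).
- move=> w_alt zero.
  have b0 : Phi2 b = 0 by apply: (zero (inr b)); rewrite mem_head.
  rewrite /= b0 word_prod0.
  case: w w_alt zero => [_ _|[a|b'] w] //=; first by rewrite [LHS]P2.
  move=> _ zero.
  have Aa : A10 a.
    by apply: zeroA; apply: (zero (inl a)); rewrite !inE eqxx !orbT.
  rewrite word_prod_mull.
  have [beta Ebeta] := opt (i1 a) [seq img y | y <- w].
  have := left beta a b Aa; rewrite -Ebeta b0 numul0l => <-.
  congr Phi; case: beta Ebeta => [y|] /= ->; by rewrite ?numulA.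
Qed.

Definition centered_word (x : A) := exists z w,
  [/\ path alt z w, {in z :: w, forall y, sum_case delta Phi2 y = 0} &
      x = word_prod (img z) [seq img y | y <- w]].

Definition base_or_word (x : A) := (exists b, x = i1 (e1 b)) \/ centered_word x.

Local Notation S := (linear_span base_or_word).

(** The only place where a letter has to be centered: c is the sum of [Phi2 c],
    which is absorbed by the next letter or, if there is none, lies in B, and of
    an element of ker Phi2. *)
Lemma span_word_letter2 (c : A2) (w : seq (A1 + A2)) : path alt (inr c) w ->
  {in w, forall y, sum_case delta Phi2 y = 0} ->
  S (word_prod (i2 c) [seq img y | y <- w]).
Proof.
have [[l1 M1] _] : star_hom i1 by case: hA.
have [[l2 M2] _] : star_hom i2 by case: hA.
have [_ _ i12 _] := hA.
have [lP2 _ P2e] := hPhi2.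
have cE : i2 c = i1 (e1 (Phi2 c)) + i2 (c - e2 (Phi2 c)).
  by have /= -> := i12 (Phi2 c); rewrite -(linD l2) addrC subrK.
have c0 : Phi2 (c - e2 (Phi2 c)) = 0 by rewrite (linB lP2) P2e subrr.
case: w => [_ _|[a|b] w] //=.
  rewrite cE; apply: (@subspaceD _ _ S); apply: span_incl.
    by left; exists (Phi2 c).
  right; exists (inr (c - e2 (Phi2 c))), [::]; split=> // y.
  by rewrite inE => /eqP ->.
move=> w_alt /forall_cons [/= a0 w0].
rewrite word_prod_mull cE numulDl -!word_prod_mull -M1.
apply: (@subspaceD _ _ S); apply: span_incl; right.
  exists (inl (e1 (Phi2 c) ** a)), w; split=> //.
    by case: (w) w_alt.
  apply/forall_cons; split=> //=.
  have Aa : A10 a by apply: delta_eq0 a0; eassumption.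
  apply: delta_ideal; [exact: he1 | exact: hdelta |].
  by have [] := bimA10 (Phi2 c) Aa.
exists (inr (c - e2 (Phi2 c))), (inl a :: w); split=> //.
by apply/forall_cons; split=> //; apply/forall_cons.
Qed.

Lemma span_mull1 a g : A10 a -> S g -> S (i1 a ** g).
Proof.
have [[l1 M1] _] : star_hom i1 by case: hA.
move=> Aa; apply: span_linear => [k x y|{}g [[b ->]|[z [w [w_alt w0 ->]]]]].
  by rewrite numulDr -nuscaleAr.
  rewrite -M1; apply: span_incl; right; exists (inl (a ** e1 b)), [::].
  split=> // y; rewrite inE => /eqP -> /=.
  apply: delta_ideal; [exact: he1 | exact: hdelta |].
  by have [] := bimA10 b Aa.
have a0 : delta a = 0 by apply: delta_ideal; eassumption.
apply: span_incl; right; case: z => [a'|b] in w_alt w0 *.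
  exists (inl (a ** a')), w; split; first by case: (w) w_alt.
    move: w0 => /forall_cons [/= a'0 w0]; apply/forall_cons; split=> //=.
    have Aa' : A10 a' by apply: delta_eq0 a'0; eassumption.
    apply: delta_ideal; [exact: he1 | exact: hdelta |].
    by case: subA10 => _ _ AM _; exact: AM.
  by rewrite /= M1 word_prod_mull.
exists (inl a), (inr b :: w); split=> //; first by apply/forall_cons.
by rewrite /= word_prod_mull.
Qed.

Lemma span_mull2 b g : S g -> S (i2 b ** g).
Proof.
have [[l2 M2] _] : star_hom i2 by case: hA.
have [_ _ i12 _] := hA.
apply: span_linear => [k x y|{}g [[b' ->]|[z [w [w_alt w0 ->]]]]].
- by rewrite numulDr -nuscaleAr.
- by have /= -> := i12 b'; rewrite -M2; exact: (@span_word_letter2 _ [::]).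
case: z => [a|b'] in w_alt w0 *.
  by rewrite -word_prod_mull; exact: (@span_word_letter2 b (inl a :: w)).
rewrite -word_prod_mull -M2; apply: span_word_letter2.
  by case: (w) w_alt.
by case/forall_cons: w0.
Qed.

Lemma centered_words_span x : S x.
Proof.
apply: (free_product_left_ind hA dirA10) => [a Aa|b|a y|b y].
- apply: span_incl; right; exists (inl a), [::]; split=> // y.
  by rewrite inE => /eqP -> /=; apply: delta_ideal; eassumption.
- exact: (@span_word_letter2 b [::]).
- exact: span_mull1.
- exact: span_mull2.
Qed.

Lemma cfree_unique (Phi Phi' : A -> B) :
  cfree_product e1 i1 i2 delta Phi2 Phi1 Phi2 Phi ->
  cfree_product e1 i1 i2 delta Phi2 Phi1 Phi2 Phi' -> Phi = Phi'.
Proof.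
move=> [[l _ Pe] Pw] [[l' _ Pe'] Pw']; apply/funext => x.
have E0 : Phi 0 = Phi' 0 by rewrite (lin0 l) (lin0 l').
have EZD k y z : Phi y = Phi' y -> Phi z = Phi' z ->
    Phi (k *: y + z) = Phi' (k *: y + z).
  by rewrite l l' => -> ->.
suff agree : forall y, base_or_word y -> Phi y = Phi' y.
  exact (@centered_words_span x
    (@LinSubspace _ _ (fun y => Phi y = Phi' y) E0 EZD) agree).
move=> y [[b ->]|[z [w [w_alt w0 ->]]]]; last by rewrite Pw ?Pw'.
by have /= -> := Pe b; have /= -> := Pe' b.
Qed.

End FreeProductFunctionals.

(** * Existence of the monotonic product *)

Section Representation.
Context (R : realType) (B : cstarAlgType R).
Context (A1 A2 A : starAlgType R) (e1 : B -> A1) (e2 : B -> A2).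
Context (he1 : star_inclusion e1) (he2 : star_inclusion e2).
Context (Phi1 : A1 -> B) (Phi2 : A2 -> B).
Context (hPhi1 : cond_exp e1 Phi1) (hPhi2 : cond_exp e2 Phi2).
Context (A10 : set A1) (subA10 : star_subalgebra A10).
Context (bimA10 : bimodule_stable e1 A10) (dirA10 : direct_sum_with e1 A10).
Context (delta : A1 -> B).
Context (hdelta : forall (l : B) (a0 : A1), A10 a0 -> delta (e1 l + a0) = l).

Local Notation C := (R[i]).
Local Notation unitization1 := (A1 * C^o)%type.
Local Notation encoding := ((A2 -> A1) * unitization1)%type.
Local Notation ideal := (ideal_part e1 delta).

Let l1 : linear e1. Proof. by case: he1 => -[[]]. Qed.
Let m1 : {morph e1 : x y / x ** y}. Proof. by case: he1 => -[[]]. Qed.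
Let l2 : linear e2. Proof. by case: he2 => -[[]]. Qed.
Let m2 : {morph e2 : x y / x ** y}. Proof. by case: he2 => -[[]]. Qed.
Let lP2 : linear Phi2. Proof. by case: hPhi2. Qed.
Let P2e b : Phi2 (e2 b) = b. Proof. by case: hPhi2. Qed.

(** The left action of A1 on its unitization; its values lie in A1. *)
Definition act (a : A1) (m : unitization1) : A1 := a ** m.1 + (m.2 : C) *: a.

Lemma act_linear a : linear (act a : unitization1 -> A1).
Proof.
move=> k m m'; rewrite /act /= numulDr -nuscaleAr scalerDl !scalerDr !scalerA.
by rewrite addrACA.
Qed.

Lemma act_linearl m : linear (act^~ m).
Proof.
move=> k a a'; rewrite /act numulDl -nuscaleAl !scalerDr !scalerA mulrC.
by rewrite addrACA.
Qed.

Lemma actM a a' m : act (a ** a') m = a ** act a' m.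
Proof. by rewrite /act numulDr numulA -nuscaleAr. Qed.

Lemma act_in a x : act a (x, 0) = a ** x.
Proof. by rewrite /act /= scale0r addr0. Qed.

(** A pair (f, m) encodes the left B-linear map on the unitization of A2 that is
    f on A2 and takes the value m at the unit; the last clause is B-linearity
    at the unit. Maps that send A2 into A1 suffice, as all actions below
    preserve this. *)
Definition coinduced_vector (p : encoding) :=
  [/\ linear p.1, forall b x, p.1 (e2 b ** x) = e1 b ** p.1 x &
      forall b, p.1 (e2 b) = act (e1 b) p.2].

Lemma coinduced0 : coinduced_vector 0.
Proof.
split=> [k x y|b x|b] /=.
  by rewrite -![(0 : A2 -> A1) _]/(0 : A1) scaler0 addr0.
  by rewrite -![(0 : A2 -> A1) _]/(0 : A1) numul0r.
by rewrite (lin0 (act_linear (e1 b))).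
Qed.

Lemma coinducedZD (k : C) p q :
  coinduced_vector p -> coinduced_vector q -> coinduced_vector (k *: p + q).
Proof.
move=> [lp Mp ep] [lq Mq eq]; split=> /=.
- exact: linear_mapZD.
- move=> b x; rewrite -![(k *: p.1 + q.1) _]/(k *: p.1 _ + q.1 _) Mp Mq.
  by rewrite numulDr nuscaleAr.
- move=> b; rewrite -![(k *: p.1 + q.1) _]/(k *: p.1 _ + q.1 _) ep eq.
  by rewrite act_linear.
Qed.

Definition coinduced_space := LinSubspace coinduced0 coinducedZD.
Local Notation W := (subspace_type coinduced_space).

Lemma coinduced_eq (p q : W) :
  (forall x, (\val p).1 x = (\val q).1 x) -> (\val p).2.1 = (\val q).2.1 ->
  (\val p).2.2 = (\val q).2.2 -> p = q.
Proof.
move=> pq1 pq2 pq3; apply: val_inj.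
case: (\val p) (\val q) pq1 pq2 pq3 => [f [m c]] [f' [m' c']] /= ff' -> ->.
by congr (_, _); apply/funext.
Qed.

Lemma coinduced_coordZD (k : C) (p q : W) :
  [/\ forall x, (\val (k *: p + q)).1 x = k *: (\val p).1 x + (\val q).1 x,
      (\val (k *: p + q)).2 = k *: (\val p).2 + (\val q).2,
      (\val (k *: p + q)).2.1 = k *: (\val p).2.1 + (\val q).2.1 &
      (\val (k *: p + q)).2.2 = k * (\val p).2.2 + (\val q).2.2].
Proof.
have -> : \val (k *: p + q) = k *: \val p + \val q by exact: linearP.
by case: (\val p) (\val q) => [f [m c]] [f' [m' c']]; split.
Qed.

(** The component of a in B acts by translation of the argument, as an element
    of A2 would, and the component in A10 through the value at the unit. *)
Definition act1_vec (a : A1) (p : encoding) : encoding :=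
  (fun x => p.1 (x ** e2 (delta a)) + e1 (Phi2 x) ** act (ideal a) p.2,
   (act a p.2, 0)).

Definition act2_vec (b : A2) (p : encoding) : encoding :=
  (fun x => p.1 (x ** b), (p.1 b, 0)).

Lemma act1_coinduced a (p : W) : coinduced_vector (act1_vec a (\val p)).
Proof.
have [lp Mp ep] := subspace_typeP p; split=> [k x y|b x|b] /=.
- rewrite numulDl -nuscaleAl lp lP2 l1 numulDl -nuscaleAl scalerDr.
  by rewrite addrACA.
- rewrite -numulA Mp (cond_exp_mull he2.1 hPhi2) ?m1 -?numulA -?numulDr //.
- rewrite Mp ep P2e -numulDr act_in; congr (_ ** _).
  by rewrite [in RHS](delta_split e1 delta a) (linD (act_linearl _) (e1 _)).
Qed.

Lemma act2_coinduced b (p : W) : coinduced_vector (act2_vec b (\val p)).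
Proof.
have [lp Mp ep] := subspace_typeP p; split=> [k x y|c x|c] /=.
- by rewrite numulDl -nuscaleAl lp.
- by rewrite -numulA Mp.
- by rewrite Mp act_in.
Qed.

Definition rep1_fun a (p : W) : W :=
  @in_subspace _ _ coinduced_space _ (act1_coinduced a p).
Definition rep2_fun b (p : W) : W :=
  @in_subspace _ _ coinduced_space _ (act2_coinduced b p).

Lemma rep1_fun_linear a : linear (rep1_fun a).
Proof.
move=> k p q; have /= [E1 E2 _ _] := coinduced_coordZD k p q.
have [F1 _ F3 F4] := coinduced_coordZD k (rep1_fun a p) (rep1_fun a q).
apply: coinduced_eq => [x||]; rewrite ?F1 ?F3 ?F4 /=.
- by rewrite E1 E2 act_linear numulDr -nuscaleAr scalerDr addrACA.
- by rewrite E2 act_linear.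
- by rewrite mulr0 addr0.
Qed.

Lemma rep2_fun_linear b : linear (rep2_fun b).
Proof.
move=> k p q; have /= [E1 _ _ _] := coinduced_coordZD k p q.
have [F1 _ F3 F4] := coinduced_coordZD k (rep2_fun b p) (rep2_fun b q).
apply: coinduced_eq => [x||]; rewrite ?F1 ?F3 ?F4 /=.
- by rewrite E1.
- by rewrite E1.
- by rewrite mulr0 addr0.
Qed.

Definition rep1 a : lin_end W :=
  @in_subspace _ _ (linear_maps W) _ (rep1_fun_linear a).
Definition rep2 b : lin_end W :=
  @in_subspace _ _ (linear_maps W) _ (rep2_fun_linear b).

(** Multiplicativity rests on [ideal_part_mul]: the A10-component of a a' is
    the B-component of a times the A10-component of a', plus the A10-component
    of a times a'. *)
Lemma rep1_hom : nualg_hom rep1.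
Proof.
split=> [k a a'|a a']; apply: val_inj; apply/funext => p;
  have [lp _ _] := subspace_typeP p.
- rewrite -[RHS]/(k *: rep1_fun a p + rep1_fun a' p).
  have [F1 _ F3 F4] := coinduced_coordZD k (rep1_fun a p) (rep1_fun a' p).
  apply: coinduced_eq => [x||]; rewrite ?F1 ?F3 ?F4 /=.
  + rewrite (delta_linear he1 subA10 dirA10 hdelta) l2 numulDr -nuscaleAr lp.
    rewrite (ideal_part_linear he1 subA10 dirA10 hdelta) act_linearl.
    by rewrite numulDr -nuscaleAr scalerDr addrACA.
  + by rewrite act_linearl.
  + by rewrite mulr0 addr0.
- rewrite -[RHS]/(rep1_fun a (rep1_fun a' p)).
  apply: coinduced_eq => [x||] //=; last by rewrite actM act_in.
  have [iM dM] := ideal_part_mul he1 subA10 bimA10 dirA10 hdelta a a'.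
  rewrite dM iM m2 numulA (linD (act_linearl _)) numulDr addrA.
  by rewrite !actM act_in numulA -m1 (cond_exp_mulr he2.1 hPhi2).
Qed.

Lemma rep2_hom : nualg_hom rep2.
Proof.
split=> [k b b'|b b']; apply: val_inj; apply/funext => p;
  have [lp _ _] := subspace_typeP p.
- rewrite -[RHS]/(k *: rep2_fun b p + rep2_fun b' p).
  have [F1 _ F3 F4] := coinduced_coordZD k (rep2_fun b p) (rep2_fun b' p).
  apply: coinduced_eq => [x||]; rewrite ?F1 ?F3 ?F4 /=.
  + by rewrite numulDr -nuscaleAr lp.
  + by rewrite lp.
  + by rewrite mulr0 addr0.
- rewrite -[RHS]/(rep2_fun b (rep2_fun b' p)).
  by apply: coinduced_eq => [x||] //=; rewrite numulA.
Qed.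

(** On B both actions are translations; at the unit this is the last clause of
    [coinduced_vector]. *)
Lemma rep12 : rep1 \o e1 =1 rep2 \o e2.
Proof.
move=> b; apply: val_inj; apply/funext => p.
have /= [_ _ ep] := subspace_typeP p.
have db : delta (e1 b) = b by exact: (delta_incl subA10 hdelta).
rewrite -[LHS]/(rep1_fun (e1 b) p) -[RHS]/(rep2_fun (e2 b) p).
apply: coinduced_eq => [x||] //=.
by rewrite /ideal_part db subrr (lin0 (act_linearl _)) numul0r addr0.
Qed.

Definition vacuum_vec : encoding := (e1 \o Phi2, (0, 1)).

Lemma vacuum_coinduced : coinduced_vector vacuum_vec.
Proof.
split=> [k x y|b x|b] /=; first by rewrite lP2 l1.
  by rewrite (cond_exp_mull he2.1 hPhi2) m1.
by rewrite P2e /act /= numul0r scale1r add0r.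
Qed.

Definition vacuum : W := @in_subspace _ _ coinduced_space _ vacuum_coinduced.

(** Right multiplication of the values by B. It commutes with the action of A,
    and this makes the resulting functional a right B-module map. *)
Definition mulr_vec (b : B) (p : encoding) : encoding :=
  (fun x => p.1 x ** e1 b, (p.2.1 ** e1 b + (p.2.2 : C) *: e1 b, 0)).

Lemma mulr_coinduced b (p : W) : coinduced_vector (mulr_vec b (\val p)).
Proof.
have [lp Mp ep] := subspace_typeP p; split=> [k x y|c x|c] /=.
- by rewrite lp numulDl nuscaleAl.
- by rewrite Mp numulA.
- by rewrite ep act_in /act numulDl numulDr numulA -nuscaleAl -nuscaleAr.
Qed.

Definition mulr (b : B) (p : W) : W :=
  @in_subspace _ _ coinduced_space _ (mulr_coinduced b p).

Lemma mulr_linear b : linear (mulr b).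
Proof.
move=> k p q; have /= [E1 _ E3 E4] := coinduced_coordZD k p q.
have [F1 _ F3 F4] := coinduced_coordZD k (mulr b p) (mulr b q).
apply: coinduced_eq => [x||]; rewrite ?F1 ?F3 ?F4 /=.
- by rewrite E1 numulDl -nuscaleAl.
- by rewrite E3 E4 numulDl -nuscaleAl scalerDl scalerDr scalerA addrACA.
- by rewrite mulr0 addr0.
Qed.

Lemma act_mulr a b m :
  act a (m.1 ** e1 b + (m.2 : C) *: e1 b, 0) = act a m ** e1 b.
Proof. by rewrite act_in /act numulDl numulDr numulA -nuscaleAl -nuscaleAr. Qed.

Lemma rep1_mulr a b p : rep1_fun a (mulr b p) = mulr b (rep1_fun a p).
Proof.
apply: coinduced_eq => [x||] //=; rewrite act_mulr.
  by rewrite [RHS]numulDl numulA.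
by rewrite scale0r addr0.
Qed.

Lemma rep2_mulr c b p : rep2_fun c (mulr b p) = mulr b (rep2_fun c p).
Proof. by apply: coinduced_eq => [x||] //=; rewrite scale0r addr0. Qed.

Section Functional.
Context (i1 : A1 -> A) (i2 : A2 -> A).
Context (hA : amalgamated_free_product e1 e2 i1 i2).
Context (h : A -> lin_end W) (hh : nualg_hom h).
Context (h1 : h \o i1 =1 rep1) (h2 : h \o i2 =1 rep2).

Local Notation "x '@>' p" := (\val (h x) p) (at level 40).
(* the value of a vector at the adjoined unit of A2 *)
Local Notation at1 p := ((\val p).2).

Let h_linear p : linear (fun x => x @> p).
Proof. by move=> k x y; rewrite hh.1 lin_endZD. Qed.

Let h_mul x y p : (x ** y) @> p = x @> (y @> p).
Proof. by rewrite hh.2 lin_endM. Qed.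

Let h1E a p : i1 a @> p = rep1_fun a p.
Proof. by rewrite [h _]h1. Qed.
Let h2E a p : i2 a @> p = rep2_fun a p.
Proof. by rewrite [h _]h2. Qed.

(** A vector obtained by applying an element of A takes its value at the unit in
    A1: the letters do so, and the last factor applied decides. *)
Lemma rep_at1_scalar x p : (at1 (x @> p)).2 = 0.
Proof.
pose P x := forall p, (at1 (x @> p)).2 = 0.
have P0 : P 0 by move=> q; rewrite (lin0 (h_linear q)).
have PZD (k : C) y z : P y -> P z -> P (k *: y + z).
  by move=> Py Pz q; rewrite h_linear /= Py Pz scaler0 addr0.
apply: (free_product_generated hA (S := LinSubspace P0 PZD)) =>
  [y z Py Pz|a|b] q.
- by rewrite h_mul Py.
- by rewrite h1E.
- by rewrite h2E.
Qed.

Lemma rep_mulr x b p : x @> mulr b p = mulr b (x @> p).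
Proof.
pose P x := forall p, x @> mulr b p = mulr b (x @> p).
have P0 : P 0.
  by move=> q; rewrite !(lin0 (h_linear _)) (lin0 (mulr_linear _)).
have PZD (k : C) y z : P y -> P z -> P (k *: y + z).
  by move=> Py Pz q; rewrite !h_linear mulr_linear Py Pz.
apply: (free_product_generated hA (S := LinSubspace P0 PZD)) =>
  [y z Py Pz|a|c] q.
- by rewrite !h_mul Pz Py.
- by rewrite !h1E rep1_mulr.
- by rewrite !h2E rep2_mulr.
Qed.

Definition monotonic_functional (x : A) : B := Phi1 (at1 (x @> vacuum)).1.
Local Notation Phi := monotonic_functional.

(** The vacuum is B-central: translation by b agrees with right multiplication
    of its values by b. *)
Lemma vacuum_base b : i2 (e2 b) @> vacuum = mulr b vacuum.
Proof.
rewrite h2E; apply: coinduced_eq => [x||] //=.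
  by rewrite (cond_exp_mulr he2.1 hPhi2) m1.
by rewrite P2e numul0l scale1r add0r.
Qed.

Lemma functional_mulr x b q :
  (at1 (x @> mulr b q)).1 = (at1 (x @> q)).1 ** e1 b.
Proof. by rewrite rep_mulr /= rep_at1_scalar scale0r addr0. Qed.

Lemma rep_sandwich (u v : option A) x y :
  (forall p, x @> p = y @> p) ->
  forall p, sandwich u v x @> p = sandwich u v y @> p.
Proof.
by move=> xy p; case: u v => [u|] [v|]; rewrite /= ?h_mul xy // h_mul.
Qed.

Lemma monotonic_functionalP :
  monotonic_product e1 e2 i1 i2 A10 Phi1 Phi2 Phi.
Proof.
have [lP1 _ P1e] := hPhi1.
have se1 : star_hom e1 by case: he1.
have se2 : star_hom e2 by case: he2.
have i12 b : i1 (e1 b) = i2 (e2 b) by case: hA => _ _ /(_ b).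
split.
- split=> [k x y|b b' x|b].
  + by rewrite /Phi h_linear /= lP1.
  + rewrite /Phi /= !h_mul i12 i12 vacuum_base h2E /=.
    have [_ _ ep] := subspace_typeP (x @> mulr b' vacuum).
    rewrite ep /act rep_at1_scalar scale0r addr0 functional_mulr.
    by rewrite (cond_exp_mull se1 hPhi1) (cond_exp_mulr se1 hPhi1) numulA.
  + by rewrite /Phi /= i12 h2E /= P2e P1e.
- split=> [a|b] /=.
    by rewrite /Phi h1E /= /act /= numul0r scale1r add0r.
  by rewrite /Phi h2E /= P1e.
- (* Already the operators a b a' and a Phi2(b) a' on W coincide. *)
  move=> u v a a' b Aa Aa'; rewrite /Phi; congr (Phi1 (at1 _).1).
  apply: rep_sandwich => p; rewrite !h_mul !h1E !h2E.
  have da' : delta a' = 0 by apply: delta_ideal Aa'; eassumption.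
  have da : delta a = 0 by apply: delta_ideal Aa; eassumption.
  apply: coinduced_eq => [x||] /=;
    by rewrite ?act_in ?da ?da' ?(lin0 l2) ?numul0r ?numul0l ?P2e.
- move=> u a b Aa; rewrite /Phi.
  have E p : at1 (i2 b @> (i1 a @> p)) = (e1 (Phi2 b) ** act a (\val p).2, 0).
    have da : delta a = 0 by apply: delta_ideal Aa; eassumption.
    rewrite h2E h1E /= da (lin0 l2) numul0r.
    have [lp _ _] := subspace_typeP p.
    by rewrite (lin0 lp) add0r /ideal_part da (lin0 l1) subr0.
  by case: u => [u|] /=; rewrite !h_mul E h1E /= (cond_exp_mull se1 hPhi1).
- (* An element of A10 only sees the value at the unit, where b applied to the
     vacuum and the vacuum times Phi2(b) agree. *)
  move=> u a b Aa; rewrite /Phi.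
  have E : i1 a @> (i2 b @> vacuum) = i1 a @> mulr (Phi2 b) vacuum.
    have da : delta a = 0 by apply: delta_ideal Aa; eassumption.
    rewrite !h1E h2E; apply: coinduced_eq => [x||] //=;
      rewrite ?numul0l ?scale1r ?add0r //.
    by rewrite da (lin0 l2) numul0r numul0l (lin0 lP2) (lin0 l1) numul0l.
  have G y : Phi1 (at1 (y @> mulr (Phi2 b) vacuum)).1 =
      Phi1 (at1 (y @> vacuum)).1 ** Phi2 b.
    by rewrite functional_mulr (cond_exp_mulr se1 hPhi1).
  by case: u => [u|]; rewrite /= !h_mul E -?h_mul; exact: G.
Qed.

End Functional.

Lemma monotonic_exists (i1 : A1 -> A) (i2 : A2 -> A) :
  amalgamated_free_product e1 e2 i1 i2 ->
  exists Phi, monotonic_product e1 e2 i1 i2 A10 Phi1 Phi2 Phi.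
Proof.
move=> hA; case: (hA) => _ _ _ univ.
have [h [[hh h1 h2] _]] := univ _ _ _ rep1_hom rep2_hom rep12.
by exists (monotonic_functional h); exact: monotonic_functionalP.
Qed.

End Representation.

(** * The identification *)

(* The function Phi is at once the unique conditional expectation defining the
   monotonic product and the unique one defining the conditionally free
   product. *)
Theorem theorem6p6 (R : realType) (B : cstarAlgType R)
  (A1 A2 : starAlgType R) (e1 : B -> A1) (e2 : B -> A2)
  (he1 : star_inclusion e1) (he2 : star_inclusion e2)
  (Phi1 : A1 -> B) (Phi2 : A2 -> B)
  (hPhi1 : cond_exp e1 Phi1) (hPhi2 : cond_exp e2 Phi2)
  (posPhi1 : positive_map Phi1) (posPhi2 : positive_map Phi2)
  (A10 : set A1) (subA10 : star_subalgebra A10)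
  (bimA10 : bimodule_stable e1 A10) (dirA10 : direct_sum_with e1 A10)
  (delta : A1 -> B)
  (hdelta : forall (l : B) (a0 : A1), A10 a0 -> delta (e1 l + a0) = l)
  (A : starAlgType R) (i1 : A1 -> A) (i2 : A2 -> A)
  (hA : amalgamated_free_product e1 e2 i1 i2) :
  exists Phi : A -> B,
    unique (monotonic_product e1 e2 i1 i2 A10 Phi1 Phi2) Phi /\
    unique (cfree_product e1 i1 i2 delta Phi2 Phi1 Phi2) Phi.
Proof.
have [Phi monPhi] :=
  monotonic_exists he1 he2 hPhi1 hPhi2 subA10 bimA10 dirA10 hdelta hA.
have mon_cfree := monotonic_cfree (Phi2 := Phi2) he1 he2 dirA10 hdelta hA.
have cf_uniq Phi' :
    cfree_product e1 i1 i2 delta Phi2 Phi1 Phi2 Phi' -> Phi = Phi'.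
  have uniq := cfree_unique he1 hPhi2 subA10 bimA10 dirA10 hdelta hA.
  exact: (uniq _ _ _ (mon_cfree _ _ monPhi)).
exists Phi; split; split; [exact: monPhi | | exact: mon_cfree monPhi |].
- by move=> Phi' monPhi'; apply/cf_uniq/mon_cfree.
- exact: cf_uniq.
Qed.
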